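(* For every GKAT expression $e\in\mathrm{Exp}$, the Thompson coalgebra $\mathcal{X}_e$ and the Thompson automaton $\mathcal{X}_e^\iota$ are well-nested.
   Context: Syntax. Fix disjoint nonempty sets $\Sigma$ (actions) and $T=\{t_1,\dots,t_n\}$ (primitive tests), $T$ finite. Boolean expressions $b,c\in\mathrm{BExp}$ are generated by $0 \mid 1 \mid t\in T \mid b\cdot c \mid b+c \mid \overline{b}$. GKAT expressions $e,f\in\mathrm{Exp}$ are generated by $p\in\Sigma \mid b\in\mathrm{BExp} \mid e\cdot f \mid e+_b f \mid e^{(b)}$. $\equiv_{BA}$ denotes Boolean equivalence, $b\le c$ iff $b+c\equiv_{BA}c$. $\mathrm{At}$ is the finite set of atoms (minimal nonzero elements) of the free Boolean algebra $\mathrm{BExp}/{\equiv_{BA}}$ on $T$. Coalgebras. Let $GX=(2+\Sigma\times X)^{\mathrm{At}}$ with $2=\{0,1\}$. A $G$-coalgebra is a pair $\mathcal{X}=\langle X,\delta^{\mathcal{X}}\rangle$ with $\delta^{\mathcal{X}}:X\to GX$; a $G$-automaton is a $G$-coalgebra with a designated start state (and is well-nested if the underlying coalgebra is). The coproduct $\mathcal{X}+\mathcal{Y}$ has the disjoint union $X+Y$ as states, with structure map $\delta^{\mathcal{X}}+\delta^{\mathcal{Y}}$ acting as $\delta^{\mathcal{X}}$ on $X$ and $\delta^{\mathcal{Y}}$ on $Y$. For $Y\subseteq X$ and $h\in GX$, the uniform continuation $\mathcal{X}[Y,h]=\langle X,\delta[Y,h]\rangle$ is given by $\delta[Y,h](x)(\alpha)=h(\alpha)$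 if $x\in Y$ and $\delta^{\mathcal{X}}(x)(\alpha)=1$, and $\delta^{\mathcal{X}}(x)(\alpha)$ otherwise. Coalgebras are identified up to renaming of states (isomorphism). Well-nested coalgebras are defined inductively: (i) if $\mathcal{X}$ has no transitions, i.e. $\delta^{\mathcal{X}}(x)(\alpha)\in2$ for all $x,\alpha$, then $\mathcal{X}$ is well-nested; (ii) if $\mathcal{X}$ and $\mathcal{Y}$ are well-nested and $h\in G(X+Y)$, then $(\mathcal{X}+\mathcal{Y})[X,h]$ is well-nested. Thompson construction. For each $e\in\mathrm{Exp}$ define a $G$-coalgebra (the Thompson coalgebra) $\mathcal{X}_e=\langle X_e,\delta_e\rangle$ and an initial pseudostate $\iota_e\in GX_e$ by recursion: - $e=b$: $X_b=\emptyset$, $\iota_b(\alpha)=1$ if $\alpha\le b$, else $0$. - $e=p$: $X_p=\{*\}$, $\delta_p( * )(\alpha)=1$ for all $\alpha$, $\iota_p(\alpha)=(p,* )$. - $e=f+_bg$: $X_e=X_f+X_g$, $\delta_e=\delta_f+\delta_g$, $\iota_e(\alpha)=\iota_f(\alpha)$ if $\alpha\le b$, $\iota_g(\alpha)$ if $\alpha\le\overline{b}$. - $e=f\cdot g$: $X_e=X_f+X_g$, $\delta_e=(\delta_f+\delta_g)[X_f,\iota_g]$, $\iota_e(\alpha)=\iota_f(\alpha)$ if $\iota_f(\alpha)\ne1$, $\iota_g(\alpha)$ if $\iota_f(\alpha)=1$. - $e=f^{(b)}$: $X_e=X_f$, $\iota_e(\alpha)=1$ if $\alpha\le\overline{b}$;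 $0$ if $\alpha\le b$ and $\iota_f(\alpha)=1$; $\iota_f(\alpha)$ if $\alpha\le b$ and $\iota_f(\alpha)\ne1$; $\delta_e=\delta_f[X_f,\iota_e]$. The Thompson automaton is $\mathcal{X}_e^\iota=\langle\{\iota\}+X_e,\delta_e^\iota,\iota\rangle$ with $\delta_e^\iota(x)=\delta_e(x)$ for $x\in X_e$ and $\delta_e^\iota(\iota)=\iota_e$. *)

(* Defs.v *)
From HB Require Import structures.
From mathcomp Require Import all_boot.
From mathcomp Require Import boolp classical_sets.

Set Implicit Arguments.
Unset Strict Implicit.
Unset Printing Implicit Defensive.

Local Open Scope classical_set_scope.
Local Open Scope quotient_scope.

Inductive bexp (T : Type) : Type :=
| BZero
| BOne
| BTest of T
| BAnd of bexp T & bexp T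
| BOr of bexp T & bexp T
| BNot of bexp T.

Arguments BZero {T}.
Arguments BOne {T}.

(* The Sigma- and T-letters live in different types, which makes the two
   alphabets disjoint. *)
Inductive exp (Sigma T : Type) : Type :=
| EAct of Sigma
| ETest of bexp T
| ESeq of exp Sigma T & exp Sigma T
| EIf of bexp T & exp Sigma T & exp Sigma T       (* f +_b g is EIf b f g *)
| EWhile of bexp T & exp Sigma T.                 (* f^(b) is EWhile b f *)

Arguments EAct {Sigma T} _.
Arguments ETest {Sigma T} _.

(* The congruence generated by the axioms of Boolean algebra, so that
   bexp T / ba_equiv is the free Boolean algebra on T. *)
Inductive ba_equiv (T : Type) : bexp T -> bexp T -> Prop :=
| ba_refl b : ba_equiv b b
| ba_sym b c : ba_equiv b c -> ba_equiv c b
| ba_trans b c d : ba_equiv b c -> ba_equiv c d -> ba_equiv b d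
| ba_congAnd b b' c c' :
    ba_equiv b b' -> ba_equiv c c' -> ba_equiv (BAnd b c) (BAnd b' c')
| ba_congOr b b' c c' :
    ba_equiv b b' -> ba_equiv c c' -> ba_equiv (BOr b c) (BOr b' c')
| ba_congNot b b' : ba_equiv b b' -> ba_equiv (BNot b) (BNot b')
| ba_orC b c : ba_equiv (BOr b c) (BOr c b)
| ba_andC b c : ba_equiv (BAnd b c) (BAnd c b)
| ba_orA b c d : ba_equiv (BOr b (BOr c d)) (BOr (BOr b c) d)
| ba_andA b c d : ba_equiv (BAnd b (BAnd c d)) (BAnd (BAnd b c) d)
| ba_orDand b c d : ba_equiv (BOr b (BAnd c d)) (BAnd (BOr b c) (BOr b d))
| ba_andDor b c d : ba_equiv (BAnd b (BOr c d)) (BOr (BAnd b c) (BAnd b d))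
| ba_or0 b : ba_equiv (BOr b BZero) b
| ba_and1 b : ba_equiv (BAnd b BOne) b
| ba_orN b : ba_equiv (BOr b (BNot b)) BOne
| ba_andN b : ba_equiv (BAnd b (BNot b)) BZero.

Definition ba_le (T : Type) (b c : bexp T) : Prop := ba_equiv (BOr b c) c.

HB.instance Definition _ (T : Type) := gen_eqMixin (bexp T).
HB.instance Definition _ (T : Type) := gen_choiceMixin (bexp T).

Section FreeBooleanAlgebra.
Variable T : Type.

Definition ba_rel : rel (bexp T) := fun b c => `[< ba_equiv b c >].

Lemma ba_rel_refl : reflexive ba_rel.
Proof. by move=> b; apply/asboolP; exact: ba_refl. Qed.

Lemma ba_rel_sym : symmetric ba_rel.
Proof. by move=> b c; apply/asboolP/asboolP; exact: ba_sym. Qed.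

Lemma ba_rel_trans : transitive ba_rel.
Proof.
by move=> c b d /asboolP bc /asboolP cd; apply/asboolP; exact: ba_trans cd.
Qed.

Canonical ba_equiv_rel := EquivRel ba_rel ba_rel_refl ba_rel_sym ba_rel_trans.

Definition free_ba := {eq_quot ba_equiv_rel}.

Definition ba_class (b : bexp T) : free_ba := \pi_({eq_quot ba_equiv_rel}) b.

Definition free_ba_le (x y : free_ba) : Prop := ba_le (repr x) (repr y).

Definition is_atom (x : free_ba) : Prop :=
  x <> ba_class BZero /\
  forall y, y <> ba_class BZero -> free_ba_le y x -> y = x.

Record atom : Type := Atom { atom_val : free_ba; atom_valP : is_atom atom_val }.

(* For an atom, not (alpha <= b) is the same as alpha <= ~ b, so the two cases
   of the guarded constructions below are the branches of an "if". *)
Definition atom_le (alpha : atom) (b : bexp T) : bool :=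
  `[< free_ba_le (atom_val alpha) (ba_class b) >].

End FreeBooleanAlgebra.

(* One component of an element of G X: reject is 0, accept is 1, and step p x
   is the pair (p, x). *)
Definition output (Sigma X : Type) : Type := (bool + Sigma * X)%type.

Definition reject {Sigma X : Type} : output Sigma X := inl false.
Definition accept {Sigma X : Type} : output Sigma X := inl true.
Definition step {Sigma X : Type} (p : Sigma) (x : X) : output Sigma X :=
  inr (p, x).

Definition is_accept {Sigma X : Type} (o : output Sigma X) : bool :=
  if o is inl true then true else false.

Definition G (Sigma T X : Type) : Type := atom T -> output Sigma X.

Definition Gmap (Sigma T X Y : Type) (f : X -> Y) (h : G Sigma T X) :
    G Sigma T Y :=
  fun alpha => match h alpha with
               | inl i => inl i
               | inr (p, x) => inr (p, f x)
               end.

Record coalgebra (Sigma T : Type) : Type := Coalgebra {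
  state :> Type;
  delta : state -> G Sigma T state
}.

Arguments Coalgebra {Sigma T} state delta.
Arguments delta {Sigma T} c _ _.

Record automaton (Sigma T : Type) : Type := Automaton {
  aut_coalgebra :> coalgebra Sigma T;
  start : aut_coalgebra
}.

Section Operations.
Variables Sigma T : Type.
Implicit Types X Y : coalgebra Sigma T.

Definition coprod X Y : coalgebra Sigma T :=
  Coalgebra (X + Y)%type (fun s => match s with
                                   | inl x => Gmap inl (delta X x)
                                   | inr y => Gmap inr (delta Y y)
                                   end).

Definition ucont X (A : set X) (h : G Sigma T X) : coalgebra Sigma T :=
  Coalgebra X (fun x alpha =>
    if (x \in A) && is_accept (delta X x alpha) then h alpha
    else delta X x alpha).

Definition coalgebra_iso X Y : Prop :=
  exists2 f : X -> Y, bijective f &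
    forall x alpha, delta Y (f x) alpha = Gmap f (delta X x) alpha.

Definition no_transitions X : Prop :=
  forall x alpha, exists i : bool, delta X x alpha = inl i.

End Operations.

(* wn_iso: coalgebras are identified up to renaming of states. *)
Inductive well_nested (Sigma T : Type) : coalgebra Sigma T -> Prop :=
| wn_base X : no_transitions X -> well_nested X
| wn_ucont X Y (h : G Sigma T (coprod X Y)) :
    well_nested X -> well_nested Y ->
    well_nested (@ucont Sigma T (coprod X Y) (range inl) h)
| wn_iso X Y : coalgebra_iso X Y -> well_nested X -> well_nested Y.

Definition automaton_well_nested (Sigma T : Type) (A : automaton Sigma T) :
  Prop := well_nested (aut_coalgebra A).

(* A coalgebra with an initial pseudostate. *)
Record pointed (Sigma T : Type) : Type := Pointed {
  pt_coalgebra : coalgebra Sigma T;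
  pt_init : G Sigma T pt_coalgebra
}.

Arguments Pointed {Sigma T} pt_coalgebra pt_init.
Arguments pt_init {Sigma T} p _.

Section Thompson.
Variables Sigma T : Type.
Implicit Types P Q : pointed Sigma T.

Definition th_test (b : bexp T) : pointed Sigma T :=
  Pointed (Coalgebra void (fun x : void => match x with end))
    (fun alpha => if atom_le alpha b then accept else reject).

Definition th_act (p : Sigma) : pointed Sigma T :=
  Pointed (Coalgebra unit (fun _ _ => accept)) (fun=> step p tt).

Definition th_if (b : bexp T) P Q : pointed Sigma T :=
  Pointed (coprod (pt_coalgebra P) (pt_coalgebra Q))
    (fun alpha => if atom_le alpha b then Gmap inl (pt_init P) alpha
                  else Gmap inr (pt_init Q) alpha).

Definition th_seq P Q : pointed Sigma T :=
  Pointed (@ucont Sigma T (coprod (pt_coalgebra P) (pt_coalgebra Q))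
             (range inl) (Gmap inr (pt_init Q)))
    (fun alpha => if is_accept (pt_init P alpha) then Gmap inr (pt_init Q) alpha
                  else Gmap inl (pt_init P) alpha).

Definition th_while_init (b : bexp T) P : G Sigma T (pt_coalgebra P) :=
  fun alpha => if atom_le alpha b then
                 if is_accept (pt_init P alpha) then reject else pt_init P alpha
               else accept.

Definition th_while (b : bexp T) P : pointed Sigma T :=
  Pointed (@ucont Sigma T (pt_coalgebra P) setT (th_while_init b P))
    (th_while_init b P).

Fixpoint thompson (e : exp Sigma T) : pointed Sigma T :=
  match e with
  | EAct p => th_act p
  | ETest b => th_test b
  | ESeq f g => th_seq (thompson f) (thompson g)
  | EIf b f g => th_if b (thompson f) (thompson g)
  | EWhile b f => th_while b (thompson f)
  end.

Definition thompson_coalgebra (e : exp Sigma T) : coalgebra Sigma T :=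
  pt_coalgebra (thompson e).

Definition thompson_init (e : exp Sigma T) :
  G Sigma T (thompson_coalgebra e) := pt_init (thompson e).

Definition thompson_automaton (e : exp Sigma T) : automaton Sigma T :=
  @Automaton Sigma T
    (Coalgebra (unit + thompson_coalgebra e)%type (fun s =>
       match s with
       | inl _ => Gmap inr (thompson_init e)
       | inr x => Gmap inr (delta (thompson_coalgebra e) x)
       end))
    (inl tt).

End Thompson.

(* Main.v *)
Require Import Defs.
From mathcomp Require Import all_boot.
From mathcomp Require Import boolp classical_sets.

Set Implicit Arguments.
Unset Strict Implicit.
Unset Printing Implicit Defensive.

(* Every construction on Thompson coalgebras is, up to isomorphism, a uniform
   continuation (X + Y)[X, h] for suitable Y and h: take h = 1 for the coproduct
   X + Y, take Y empty for X[X, h], and take X to be a single accepting state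
   for adjoining the initial state. *)

Lemma mem_range_inl (A B : Type) (a : A) :
  ((inl a : (A + B)%type) \in range (@inl A B)) = true.
Proof. by apply/mem_set; exists a. Qed.

Lemma notin_range_inl (A B : Type) (b : B) :
  ((inr b : (A + B)%type) \in range (@inl A B)) = false.
Proof. by apply: memNset => -[]. Qed.

Section WellNested.
Variables Sigma T : Type.
Implicit Types X Y : coalgebra Sigma T.

(** The identity is an isomorphism here, so structure maps need only be compared pointwise. *)
Lemma well_nested_eq_delta (S : Type) (d d' : S -> G Sigma T S) :
  (forall x alpha, d' x alpha = d x alpha) ->
  well_nested (Coalgebra S d) -> well_nested (Coalgebra S d').
Proof.
move=> dd'; apply: wn_iso; exists id; first by exists id.
by move=> x alpha /=; rewrite dd' /Gmap; case: (d x alpha) => [|[]].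
Qed.

Lemma well_nested_coprod X Y :
  well_nested X -> well_nested Y -> well_nested (coprod X Y).
Proof.
move=> wX wY; have := @wn_ucont _ _ _ _ (fun=> accept) wX wY.
apply: well_nested_eq_delta => s alpha.
(* Only outputs that already are [accept] get replaced, and they are replaced by [accept]. *)
case: ifP => // /andP[_] /=.
by case: (match s with inl _ => _ | inr _ => _ end alpha) => [[]|].
Qed.

Lemma well_nested_empty (d : void -> G Sigma T void) :
  well_nested (Coalgebra void d).
Proof. by apply: wn_base => -[]. Qed.

Lemma well_nested_ucontT X (h : G Sigma T X) :
  well_nested X -> well_nested (@ucont Sigma T X setT h).
Proof.
move=> wX; pose V : coalgebra Sigma T := Coalgebra void (of_void _).
pose k : G Sigma T (coprod X V) := Gmap inl h.
apply: wn_iso (wn_ucont k wX (well_nested_empty _)).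
(* The inverse of [inl]; as [V] has no states, it carries [range inl] onto [setT] and [k] back to
   [h]. *)
exists (fun s : X + void => match s with inl x => x | inr v => of_void X v end).
  by exists inl => // -[].
case=> [x|[]] alpha /=; rewrite [in RHS]/Gmap mem_range_inl in_setT /= /k /Gmap.
case: (delta X x alpha) => [[]|[p y]] //=.
by case: (h alpha) => [|[]].
Qed.

Lemma well_nested_adjoin X (h : G Sigma T X) :
  well_nested X ->
  well_nested (Coalgebra (unit + X)%type (fun s => match s with
    | inl _ => Gmap inr h
    | inr x => Gmap inr (delta X x)
    end)).
Proof.
move=> wX; pose U : coalgebra Sigma T := Coalgebra unit (fun _ _ => accept).
have wU : well_nested U by apply: wn_base => u alpha; exists true.
pose k : G Sigma T (coprod U X) := Gmap inr h.
(* The state of [U] accepts every atom, so all its outputs become those of [k]; states of [X] lie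
   outside [range inl] and keep theirs. *)
apply: well_nested_eq_delta (wn_ucont k wU wX) => -[u|x] alpha.
  by rewrite mem_range_inl.
by rewrite notin_range_inl.
Qed.

Lemma well_nested_thompson (e : exp Sigma T) :
  well_nested (thompson_coalgebra e).
Proof.
elim: e => [p|b|f wf g wg|b f wf g wg|b f wf].
- by apply: wn_base => x alpha; exists true.
- exact: well_nested_empty.
(* Sequencing is literally an instance of the inductive clause, with the injected pseudostate of [g]
   as continuation. *)
- exact: wn_ucont.
- exact: well_nested_coprod.
- exact: well_nested_ucontT.
Qed.

End WellNested.

Theorem theorem4p9 (Sigma : Type) (T : finType)
    (hSigma : inhabited Sigma) (hT : inhabited T) (e : exp Sigma T) :
  well_nested (thompson_coalgebra e) /\
  automaton_well_nested (thompson_automaton e).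
Proof.
split; first exact: well_nested_thompson.
exact/well_nested_adjoin/well_nested_thompson.
Qed.
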